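(* Let $\alpha_e=-\min(0,\lambda_{\min}(Q))$ and $\alpha_g=-\min(0,\lambda_{\min}(Q,I_n+A^TA))$. Denote by $\mu_{\mathrm{EIG}}$ the optimal objective function value of $$\min_{x\in\mathcal X}\ x^T(Q+\alpha_eI_n)x+\big(q-\alpha_e(l+u)\big)^Tx+\alpha_e\,l^Tu,$$ and by $\mu_{\mathrm{GEIG}}$ the optimal objective function value of $$\min_{x\in\mathcal X}\ x^T\big(Q+\alpha_g(I_n+A^TA)\big)x+\big(q-\alpha_g(l+u+2A^Tb)\big)^Tx+\alpha_g(l^Tu+b^Tb).$$ Then $\mu_{\mathrm{GEIG}}\ge\mu_{\mathrm{EIG}}$.
   Context: $Q\in\mathbb R^{n\times n}$ is symmetric, $q\in\mathbb R^n$, and $\mathcal X=\{x\in\mathbb R^n: Ax=b,\ Cx\le d,\ l\le x\le u\}$ with $A\in\mathbb R^{m\times n}$, $b\in\mathbb R^m$, $C\in\mathbb R^{p\times n}$, $d\in\mathbb R^p$, and finite bounds $-\infty<l_i<u_i<\infty$ for all $i$. $I_n$ is the identity, $\lambda_{\min}(M)$ is the smallest eigenvalue of a symmetric matrix $M$, and for symmetric $M,N$ with $N\succ0$ (positive definite), $\lambda_{\min}(M,N)$ is the smallest generalized eigenvalue of $Mv=\lambda Nv$, i.e. $\lambda_{\min}(M,N)=\min_{x\ne0}\frac{x^TMx}{x^TNx}$. *)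

(* Defs.v *)
From HB Require Import structures.
From mathcomp Require Import all_boot all_order all_algebra.
From mathcomp Require Import all_classical all_reals all_analysis.

Set Implicit Arguments.
Unset Strict Implicit.
Unset Printing Implicit Defensive.

Import Order.TTheory GRing.Theory Num.Theory.

Local Open Scope classical_set_scope.
Local Open Scope ring_scope.

Definition dotv (R : realType) (n : nat) (x y : 'cV[R]_n) : R :=
  (x^T *m y) 0 0.

Definition qform (R : realType) (n : nat) (M : 'M[R]_n) (x : 'cV[R]_n) : R :=
  (x^T *m M *m x) 0 0.

(* For symmetric M the set below is finite, and nonempty when 0 < n, so the
   infimum is the least eigenvalue. [eigenvalue] uses row eigenvectors, which
   gives the same eigenvalues as column eigenvectors. *)
Definition lambda_min (R : realType) (n : nat) (M : 'M[R]_n) : R :=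
  inf [set a : R | eigenvalue M a].

Definition geigenvalue (R : realType) (n : nat) (M N : 'M[R]_n) (a : R) : Prop :=
  exists v : 'cV[R]_n, v != 0 /\ M *m v = a *: (N *m v).

(* Meaningful for symmetric M and symmetric positive definite N: the set is
   then finite, and nonempty when 0 < n. *)
Definition gen_lambda_min (R : realType) (n : nat) (M N : 'M[R]_n) : R :=
  inf [set a : R | geigenvalue M N a].

Definition feasible (R : realType) (m n p : nat)
    (A : 'M[R]_(m, n)) (b : 'cV[R]_m) (C : 'M[R]_(p, n)) (d : 'cV[R]_p)
    (l u : 'cV[R]_n) : set 'cV[R]_n :=
  [set x | [/\ A *m x = b,
               forall i, (C *m x) i 0 <= d i 0 &
               forall i, l i 0 <= x i 0 <= u i 0]].

(* Optimal value of the minimization of f over X; it is +oo when X is empty. *)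
Definition optval (R : realType) (n : nat) (X : set 'cV[R]_n)
    (f : 'cV[R]_n -> R) : \bar R :=
  ereal_inf [set (f x)%:E | x in X].

(* Main.v *)
Require Import Defs.
From HB Require Import structures.
From mathcomp Require Import all_boot all_order all_algebra.
From mathcomp Require Import all_classical all_reals all_analysis.
From mathcomp Require Import ring lra.
Import Order.TTheory GRing.Theory Num.Theory.
Local Open Scope classical_set_scope.
Local Open Scope ring_scope.

(** Write [|y|^2] for [dotv y y].  Completing the products shows that the two
    objectives are
      [x^T Q x + q^T x + alpha_e (x - l)^T (x - u)]  and
      [x^T Q x + q^T x + alpha_g ((x - l)^T (x - u) + |A x - b|^2)].
    On the feasible set the residual [A x - b] vanishes and the box constraints
    make [(x - l)^T (x - u)] nonpositive, so the second objective dominates the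
    first one pointwise as soon as [alpha_g <= alpha_e]
    ([le_box_penalty]), and the optimal values compare accordingly.

    The inequality [alpha_g <= alpha_e] says that a negative generalized
    eigenvalue [a] of the pair [(Q, G)], [G = I + A^T A], is at least the least
    eigenvalue of [Q].  If [Q v = a G v] then
    [v^T Q v = a v^T G v <= a |v|^2] because [a < 0] and [v^T G v >= |v|^2],
    whereas [v^T Q v >= lambda_min Q * |v|^2] by the Rayleigh bound
    ([lambda_min_rayleigh]).

    The Rayleigh bound rests on [least_eigenvalue]: the largest [t] such that
    [Q - t I] is positive semidefinite is an eigenvalue of [Q].  Indeed a
    semidefinite matrix [M] satisfies [|M x|^2 <= K x^T M x] for some [K]; if
    [M] were moreover invertible, [|x|^2] would be bounded by a multiple of
    [|M x|^2], hence of [x^T M x], and [t] could be increased. *)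

(** * The inner product and quadratic forms *)

Section SymmetricForms.
Set Implicit Arguments.
Unset Strict Implicit.
Context {R : realType}.

Lemma dotvE n (x y : 'cV[R]_n) : dotv x y = \sum_i x i 0 * y i 0.
Proof. by rewrite /dotv mxE; apply: eq_bigr => i _; rewrite mxE. Qed.

Lemma dotvC n (x y : 'cV[R]_n) : dotv x y = dotv y x.
Proof. by rewrite !dotvE; apply: eq_bigr => i _; rewrite mulrC. Qed.

Lemma dotvDr n (x y z : 'cV[R]_n) : dotv x (y + z) = dotv x y + dotv x z.
Proof. by rewrite /dotv mulmxDr mxE. Qed.

Lemma dotvZr n a (x y : 'cV[R]_n) : dotv x (a *: y) = a * dotv x y.
Proof. by rewrite /dotv -scalemxAr mxE. Qed.

Lemma dotvNr n (x y : 'cV[R]_n) : dotv x (- y) = - dotv x y.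
Proof. by rewrite /dotv mulmxN mxE. Qed.

Lemma dotvDl n (x y z : 'cV[R]_n) : dotv (x + y) z = dotv x z + dotv y z.
Proof. by rewrite !(dotvC _ z) dotvDr. Qed.

Lemma dotvZl n a (x y : 'cV[R]_n) : dotv (a *: x) y = a * dotv x y.
Proof. by rewrite !(dotvC _ y) dotvZr. Qed.

Lemma dotvNl n (x y : 'cV[R]_n) : dotv (- x) y = - dotv x y.
Proof. by rewrite !(dotvC _ y) dotvNr. Qed.

Lemma dotv_mull m n (M : 'M[R]_(m, n)) (x : 'cV[R]_n) (y : 'cV[R]_m) :
  dotv (M *m x) y = dotv x (M^T *m y).
Proof. by rewrite /dotv trmx_mul mulmxA. Qed.

Lemma sqr_le_dotv n (x : 'cV[R]_n) i : x i 0 ^+ 2 <= dotv x x.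
Proof.
rewrite dotvE (bigD1 i) //= expr2 lerDl sumr_ge0 // => j _.
by rewrite -expr2 sqr_ge0.
Qed.

Lemma dotv_ge0 n (x : 'cV[R]_n) : 0 <= dotv x x.
Proof. by rewrite dotvE sumr_ge0 // => i _; rewrite -expr2 sqr_ge0. Qed.

Lemma dotv_gt0 n (x : 'cV[R]_n) : x != 0 -> 0 < dotv x x.
Proof.
move=> x0; rewrite lt_def dotv_ge0 andbT; apply: contra x0 => /eqP xx0.
apply/eqP/matrixP => i j; rewrite ord1 mxE.
apply/eqP; rewrite -sqrf_eq0 eq_le sqr_ge0 andbT -xx0.
exact: sqr_le_dotv.
Qed.

Lemma qformE n (M : 'M[R]_n) x : qform M x = dotv x (M *m x).
Proof. by rewrite /qform /dotv mulmxA. Qed.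

Lemma qformD n (M N : 'M[R]_n) x : qform (M + N) x = qform M x + qform N x.
Proof. by rewrite !qformE mulmxDl dotvDr. Qed.

Lemma qformZ n a (M : 'M[R]_n) x : qform (a *: M) x = a * qform M x.
Proof. by rewrite !qformE -scalemxAl dotvZr. Qed.

Lemma qform1 n (x : 'cV[R]_n) : qform 1%:M x = dotv x x.
Proof. by rewrite qformE mul1mx. Qed.

Lemma qform_gram m n (A : 'M[R]_(m, n)) (x : 'cV[R]_n) :
  qform (A^T *m A) x = dotv (A *m x) (A *m x).
Proof. by rewrite qformE -mulmxA -dotv_mull. Qed.

Lemma qform_sub_scalar n (M : 'M[R]_n) t x :
  qform (M - t%:M) x = qform M x - t * dotv x x.
Proof. by rewrite -scalemx1 -scaleNr qformD qformZ qform1 mulNr. Qed.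

(** Each term [x_i M_ij x_j] is at most [|M_ij| |x|^2] because
    [|x_i x_j| <= (x_i^2 + x_j^2) / 2]. *)
Lemma qform_bounded n (M : 'M[R]_n) :
  exists2 K, 0 < K & forall x, `|qform M x| <= K * dotv x x.
Proof.
exists (1 + \sum_i \sum_j `|M i j|).
  by rewrite ltr_pwDl // sumr_ge0 // => i _; rewrite sumr_ge0.
move=> x; rewrite mulrDl mul1r -[leLHS]add0r lerD ?dotv_ge0 //.
rewrite qformE dotvE mulr_suml (le_trans (ler_norm_sum _ _ _)) //.
apply: ler_sum => i _; rewrite mxE mulr_sumr mulr_suml.
rewrite (le_trans (ler_norm_sum _ _ _)) //; apply: ler_sum => j _.
rewrite mulrCA normrM ler_wpM2l // ler_norml.
have xi := sqr_le_dotv x i; have xj := sqr_le_dotv x j.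
by apply/andP; split; nra.
Qed.

(** * The least eigenvalue of a symmetric matrix *)

Definition rayleigh_lb n (M : 'M[R]_n) (t : R) :=
  forall x, t * dotv x x <= qform M x.

(** Positivity of the form at [x - K^-1 (M x)], where [K] bounds the form from
    above. *)
Lemma psd_mulmx_bounded n (M : 'M[R]_n) : M^T = M ->
  (forall x, 0 <= qform M x) ->
  exists2 K, 0 < K & forall x, dotv (M *m x) (M *m x) <= K * qform M x.
Proof.
move=> M_sym M_psd; have [K K0 KM] := qform_bounded M.
exists K => // x; set y := M *m x.
have := M_psd (x - K^-1 *: y).
have -> : qform M (x - K^-1 *: y)
    = qform M x - 2 * K^-1 * dotv y y + K^-1 ^+ 2 * qform M y.
  have xMy : dotv x (M *m y) = dotv y y by rewrite -{1}M_sym -dotv_mull.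
  rewrite !qformE mulmxBr -scalemxAr -/y.
  by rewrite !(dotvDl, dotvDr, dotvNl, dotvNr, dotvZl, dotvZr) xMy; ring.
have My : K^-1 ^+ 2 * qform M y <= K^-1 * dotv y y.
  rewrite expr2 -mulrA ler_pM2l ?invr_gt0 // ler_pdivrMl //.
  by rewrite (le_trans (ler_norm _)).
move=> h; rewrite mulrC -ler_pdivrMr // mulrC; lra.
Qed.

Lemma psd_unitmx_coercive n (M : 'M[R]_n) : M^T = M ->
  (forall x, 0 <= qform M x) -> M \in unitmx ->
  exists2 e, 0 < e & rayleigh_lb M e.
Proof.
move=> M_sym M_psd M_unit.
have [K K0 KM] := psd_mulmx_bounded M_sym M_psd.
have [L L0 LM] := qform_bounded ((invmx M)^T *m invmx M).
exists (L * K)^-1; first by rewrite invr_gt0 mulr_gt0.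
move=> x; rewrite ler_pdivrMl ?mulr_gt0 // -mulrA.
apply: (@le_trans _ _ (L * dotv (M *m x) (M *m x))); last by rewrite ler_pM2l.
apply: le_trans (LM _); apply: le_trans (ler_norm _).
by rewrite qform_gram mulKmx.
Qed.

(** A nonzero vector makes the set of Rayleigh lower bounds bounded above; its
    supremum [t] leaves [M - t I] semidefinite but not coercive, hence
    singular. *)
Lemma least_eigenvalue n (M : 'M[R]_n) (v : 'cV[R]_n) :
  M^T = M -> v != 0 -> exists2 t, eigenvalue M t & rayleigh_lb M t.
Proof.
move=> M_sym v0; set S := [set t : R | rayleigh_lb M t].
have ubS x : x != 0 -> ubound S (qform M x / dotv x x).
  by move=> x0 t tS; rewrite ler_pdivlMr ?dotv_gt0.
have hasS : has_sup S.
  split; last by exists (qform M v / dotv v v); exact: ubS.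
  have [K K0 KM] := qform_bounded M; exists (- K) => x.
  by have := KM x; rewrite ler_norml mulNr => /andP[].
have lb_sup : rayleigh_lb M (sup S).
  move=> x; have [->|x0] := eqVneq x 0.
    by rewrite qformE mulmx0 /dotv mulmx0 mxE mulr0.
  by rewrite -ler_pdivlMr ?dotv_gt0 // ge_sup //; [case: hasS | exact: ubS].
exists (sup S) => //; rewrite /eigenvalue /eigenspace kermx_eq0 row_free_unit.
apply/negP => N_unit.
have [||e e0 eN] := psd_unitmx_coercive _ _ N_unit.
- by rewrite linearB /= M_sym tr_scalar_mx.
- by move=> x; rewrite qform_sub_scalar subr_ge0.
have : S (sup S + e).
  move=> x; have := eN x; rewrite qform_sub_scalar mulrDl; lra.
by move=> /(ub_le_sup (proj2 hasS)); lra.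
Qed.

Lemma eigenvalue_ge_rayleigh_lb n (M : 'M[R]_n) t a : M^T = M ->
  rayleigh_lb M t -> eigenvalue M a -> t <= a.
Proof.
move=> M_sym tM /eigenvalueP[w wM w0].
have w'0 : w^T != 0 by rewrite -[0]trmx0 (inj_eq trmx_inj).
rewrite -(@ler_pM2r _ (dotv w^T w^T)) ?dotv_gt0 //.
apply: le_trans (tM _) _.
by rewrite qformE -[in M *m _]M_sym -trmx_mul wM linearZ /= dotvZr.
Qed.

(** The eigenvalue given by [least_eigenvalue] is one of those whose infimum
    defines [lambda_min M], and this infimum is a genuine one because every
    Rayleigh lower bound is below all eigenvalues. *)
Lemma lambda_min_rayleigh n (M : 'M[R]_n) (v : 'cV[R]_n) : M^T = M ->
  lambda_min M * dotv v v <= qform M v.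
Proof.
move=> M_sym; have [->|v0] := eqVneq v 0.
  by rewrite qformE mulmx0 /dotv mulmx0 mxE mulr0.
have [t Mt tM] := least_eigenvalue M_sym v0.
apply: le_trans (tM v); rewrite ler_wpM2r ?dotv_ge0 //.
apply: ge_inf => //; exists t => a; exact: eigenvalue_ge_rayleigh_lb.
Qed.

(** * Comparison of the two penalty parameters *)

(** A generalized eigenvalue [a >= 0] needs no argument.  If [a < 0], its
    eigenvector [v] gives [lambda_min Q * |v|^2 <= v^T Q v = a v^T N v], and
    [v^T N v >= |v|^2] turns this into [lambda_min Q <= a]. *)
Lemma min0_lambda_min_le_gen n (Q N : 'M[R]_n) : Q^T = Q ->
  (forall v, dotv v v <= qform N v) ->
  Num.min 0 (lambda_min Q) <= Num.min 0 (gen_lambda_min Q N).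
Proof.
move=> Q_sym N_ge1; rewrite le_min ge_min lexx /= /gen_lambda_min.
set S := (X in inf X).
(* With no generalized eigenvalue, as in dimension 0, [inf set0 = 0]. *)
have [->|/set0P S0] := eqVneq S set0; first by rewrite inf0 ge_min lexx.
apply: lb_le_inf => // a [v [v0 Qv]].
rewrite ge_min; have [//|a0] := leP 0 a; rewrite /=.
rewrite -(@ler_pM2r _ (dotv v v)) ?dotv_gt0 //.
apply: le_trans (lambda_min_rayleigh _ Q_sym) _.
by rewrite qformE Qv dotvZr -qformE ler_wnM2l // ltW.
Qed.

Lemma qform_1Dgram_ge m n (A : 'M[R]_(m, n)) (v : 'cV[R]_n) :
  dotv v v <= qform (1%:M + A^T *m A) v.
Proof. by rewrite qformD qform1 qform_gram lerDl dotv_ge0. Qed.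

(** * Comparison of the two objectives *)

Lemma box_product_le0 n (l u x : 'cV[R]_n) :
  (forall i, l i 0 <= x i 0 <= u i 0) -> dotv (x - l) (x - u) <= 0.
Proof.
move=> lxu; rewrite dotvE sumr_le0 // => i _; rewrite !mxE.
have /andP[lx xu] := lxu i.
by rewrite mulr_ge0_le0 ?subr_ge0 ?subr_le0.
Qed.

Lemma eig_objectiveE n (Q : 'M[R]_n) (q l u x : 'cV[R]_n) a :
  qform (Q + a *: 1%:M) x + dotv (q - a *: (l + u)) x + a * dotv l u
  = qform Q x + dotv q x + a * dotv (x - l) (x - u).
Proof.
rewrite qformD qformZ qform1.
rewrite !(dotvDl, dotvDr, dotvNl, dotvNr, dotvZl, dotvZr) (dotvC x u).
by ring.
Qed.

Lemma geig_objectiveE m n (Q : 'M[R]_n) (A : 'M[R]_(m, n)) (b : 'cV[R]_m)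
    (q l u x : 'cV[R]_n) a :
  qform (Q + a *: (1%:M + A^T *m A)) x
  + dotv (q - a *: (l + u + 2 *: (A^T *m b))) x + a * (dotv l u + dotv b b)
  = qform Q x + dotv q x
    + a * (dotv (x - l) (x - u) + dotv (A *m x - b) (A *m x - b)).
Proof.
rewrite qformD qformZ qformD qform1 qform_gram.
rewrite !(dotvDl, dotvDr, dotvNl, dotvNr, dotvZl, dotvZr) (dotvC x u).
by rewrite (dotv_mull A^T) trmxK (dotvC (A *m x) b); ring.
Qed.

(** Once the residual vanishes, both penalties are multiples of the same
    nonpositive quantity, so the larger parameter gives the smaller value. *)
Lemma le_box_penalty m n p (Q : 'M[R]_n) (q : 'cV[R]_n)
    (A : 'M[R]_(m, n)) (b : 'cV[R]_m) (C : 'M[R]_(p, n)) (d : 'cV[R]_p)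
    (l u x : 'cV[R]_n) ag ae : ag <= ae -> feasible A b C d l u x ->
  qform (Q + ae *: 1%:M) x + dotv (q - ae *: (l + u)) x + ae * dotv l u
  <= qform (Q + ag *: (1%:M + A^T *m A)) x
     + dotv (q - ag *: (l + u + 2 *: (A^T *m b))) x
     + ag * (dotv l u + dotv b b).
Proof.
move=> ag_ae [Axb _ /box_product_le0 box].
rewrite eig_objectiveE geig_objectiveE Axb subrr /(dotv 0 _) mulmx0 mxE addr0.
by rewrite lerD2l ler_wnM2r.
Qed.

End SymmetricForms.

Theorem proposition4 (R : realType) (m n p : nat)
    (Q : 'M[R]_n) (q : 'cV[R]_n)
    (A : 'M[R]_(m, n)) (b : 'cV[R]_m) (C : 'M[R]_(p, n)) (d : 'cV[R]_p)
    (l u : 'cV[R]_n)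
    (Q_sym : Q^T = Q) (lt_lu : forall i, l i 0 < u i 0) :
  let X := feasible A b C d l u in
  let G := 1%:M + A^T *m A in
  let alpha_e := - Num.min 0 (lambda_min Q) in
  let alpha_g := - Num.min 0 (gen_lambda_min Q G) in
  let mu_EIG := optval X (fun x =>
    qform (Q + alpha_e *: 1%:M) x
    + dotv (q - alpha_e *: (l + u)) x
    + alpha_e * dotv l u) in
  let mu_GEIG := optval X (fun x =>
    qform (Q + alpha_g *: G) x
    + dotv (q - alpha_g *: (l + u + 2 *: (A^T *m b))) x
    + alpha_g * (dotv l u + dotv b b)) in
  ((mu_GEIG >= mu_EIG)%E : Prop).
Proof.
move=> X G alpha_e alpha_g mu_EIG mu_GEIG.
have alpha_ge : alpha_g <= alpha_e.
  rewrite /alpha_g /alpha_e lerN2; apply: min0_lambda_min_le_gen => //.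
  exact: qform_1Dgram_ge.
apply: le_ereal_inf_tmp => _ [x Xx <-].
apply: (@le_trans _ _ (qform (Q + alpha_e *: 1%:M) x
  + dotv (q - alpha_e *: (l + u)) x + alpha_e * dotv l u)%:E).
  by apply: ereal_inf_lbound; exists x.
by rewrite lee_fin; exact: le_box_penalty Xx.
Qed.
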